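(* Let $\mathscr{A}$ be a Riemannian Rinehart space over a ground ring $\mathbb{K}$, with function space $\mathcal{O}$, tangent space $\mathfrak{X}$ and cotangent space $\Omega$, and suppose that $2$ is a unit in $\mathbb{K}$. If the Riemannian metric is non-degenerate, then any Levi-Civita connection on $\mathscr{A}$ is necessarily unique. If the Riemannian metric is moreover duplicative and $(\mathfrak{X},\Omega)$ is isomorphic with $(\mathfrak{X},\mathfrak{X}^\vee)$ as dual pairs, where $\mathfrak{X}^\vee=\operatorname{Hom}_{\mathcal{O}}(\mathfrak{X},\mathcal{O})$ with the evaluation pairing, then a Levi-Civita connection on $\mathscr{A}$ certainly exists.
   Context: All rings and algebras (except Lie algebras) are associative and commutative; all algebras are over a fixed ground ring $\mathbb{K}$. A dual pair consists of a $\mathbb{K}$-algebra $\mathcal{O}$, two $\mathcal{O}$-modules $M$ (primary) and $W$ (secondary) and an $\mathcal{O}$-bilinear pairing $\langle\cdot,\cdot\rangle:M\otimes_{\mathcal{O}} W\to\mathcal{O}$. A morphism of dual pairs consists of a $\mathbb{K}$-algebra homomorphism $\rho^*$ of the underlying algebras and $\rho^*$-equivariant module homomorphisms $\rho^\sharp,\rho^\flat$ of primary and secondary modules with $\rho^*\langle X,\omega\rangle=\langle\rho^\sharp X,\rho^\flat\omega\rangle$. Non-degeneracy: let $F:M_1\otimes_{\mathcal{O}} M_2\to\mathcal{O}$ be a bilinear form. If $M_1\otimes_{\mathcal{O}} M_2$ is not the zero module, $F$ is called non-degenerate if for every nonzero $X\in M_1$ the map $F(X\otimes\cdot)$ is not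 the zero map and for every nonzero $Y\in M_2$ the map $F(\cdot\otimes Y)$ is not the zero map. If $M_1\otimes_{\mathcal{O}} M_2$ is the zero module, $F$ is called non-degenerate by convention. A Rinehart space $\mathscr{A}$ is a dual pair with algebra $\mathcal{O}$ (function space), primary module $\mathfrak{X}$ (tangent space) and secondary module $\Omega$ (cotangent space), together with a $\mathbb{K}$-Lie algebra structure on $\mathfrak{X}$ and a $\mathbb{K}$-linear map $\mathrm{d}:\mathcal{O}\to\Omega$ with $\mathrm{d}(fg)=f\,\mathrm{d}g+g\,\mathrm{d}f$, such that, writing $\mathrm{d}_Xf:=\langle X,\mathrm{d}f\rangle$, one has $[X,fY]=(\mathrm{d}_Xf)Y+f[X,Y]$ for all $X,Y\in\mathfrak{X}$, $f\in\mathcal{O}$; moreover (1) $\mathfrak{X}$ and $\Omega$ are finite-dimensional over $\mathcal{O}$ (the dimension of a module is the largest cardinality of an $\mathcal{O}$-linearly independent subset), (2) $\Omega$ is spanned over $\mathcal{O}$ by $\mathrm{d}\mathcal{O}$, (3) the pairing between $\mathfrak{X}$ and $\Omega$ is non-degenerate. A Riemannian metric is a symmetric $\mathcal{O}$-bilinear form $\langle\cdot,\cdot\rangle:\mathfrak{X}\otimes_{\mathcal{O}}\mathfrak{X}\to\mathcal{O}$; a Riemannian Rinehart space is a Rinehart space with a Riemannian metric. Elements $Y\in\mathfrak{X}$ and $\omega\in\Omega$ are duplicates of each other if $\langle X,\omega\rangle=\langle X,Y\rangle$ for all $X\in\mathfrak{X}$. The metric is duplicative if every $Y\in\mathfrak{X}$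 has a duplicate in $\Omega$ and every $\omega\in\Omega$ has a duplicate in $\mathfrak{X}$. A covariant derivative is a map $\nabla$ assigning $\mathcal{O}$-linearly to each $X\in\mathfrak{X}$ a $\mathbb{K}$-linear map $\nabla_X:\mathfrak{X}\to\mathfrak{X}$ with $\nabla_X(fY)=(\mathrm{d}_Xf)Y+f\nabla_XY$. It is a Levi-Civita connection if $[X,Y]=\nabla_XY-\nabla_YX$ and $\mathrm{d}_X\langle Y,Z\rangle=\langle\nabla_XY,Z\rangle+\langle Y,\nabla_XZ\rangle$ for all $X,Y,Z\in\mathfrak{X}$. *)

(* Defs.v *)
From HB Require Import structures.
From mathcomp Require Import all_boot all_order all_algebra.
From mathcomp Require Import boolp classical_sets functions cardinality.
Set Implicit Arguments.
Unset Strict Implicit.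
Unset Printing Implicit Defensive.
Import GRing.Theory.
Local Open Scope ring_scope.
Local Open Scope classical_set_scope.
Local Open Scope card_scope.

(* Rings are unital and possibly zero ("pz" structures), so that zero algebras
   and zero modules are covered. The library's {bilinear _ -> _ -> _} and
   comAlgType require 1 != 0, which is why bilinearity is spelled out here and
   why a K-algebra is given by its structure morphism K -> O. *)

Section Modules.
Variable O : comPzRingType.

Record is_bilinear (M W P : lmodType O) (F : M -> W -> P) : Prop := {
  bilinDl : forall x y w, F (x + y) w = F x w + F y w;
  bilinZl : forall a x w, F (a *: x) w = a *: F x w;
  bilinDr : forall x v w, F x (v + w) = F x v + F x w;
  bilinZr : forall a x w, F x (a *: w) = a *: F x w
}.

Definition is_bilinear_form (M W : lmodType O) (F : M -> W -> O) : Prop :=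
  @is_bilinear M W O^o F.

(* (T, tau) has the universal property of the tensor product of M and W. *)
Definition is_tensor_product (M W T : lmodType O) (tau : M -> W -> T) : Prop :=
  is_bilinear tau /\
  forall (P : lmodType O) (b : M -> W -> P), is_bilinear b ->
    exists! phi : {linear T -> P}, forall x w, phi (tau x w) = b x w.

(* Tensor products exist and are unique up to isomorphism, so this says that
   "the" tensor product of M and W is the zero module. *)
Definition tensor_is_zero (M W : lmodType O) : Prop :=
  exists (T : lmodType O) (tau : M -> W -> T),
    is_tensor_product tau /\ forall t : T, t = 0.

(* F stands for the induced form on the tensor product of M and W; when that
   module is zero, F is non-degenerate by convention. *)
Definition is_nondegenerate (M W : lmodType O) (F : M -> W -> O) : Prop :=
  ~ tensor_is_zero M W ->
  (forall x : M, x <> 0 -> exists w, F x w <> 0) /\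
  (forall w : W, w <> 0 -> exists x, F x w <> 0).

Definition lin_indep (M : lmodType O) (A : set M) : Prop :=
  forall s : seq M, uniq s -> [set` s] `<=` A ->
  forall c : M -> O, \sum_(x <- s) c x *: x = 0 ->
  forall x, x \in s -> c x = 0.

Definition has_dimension (M : lmodType O) (n : nat) : Prop :=
  (exists2 A : set M, lin_indep A & A #= `I_n) /\
  (forall A : set M, lin_indep A -> A #<= `I_n).

Definition finite_dimensional (M : lmodType O) : Prop :=
  exists n, has_dimension M n.

Definition dual (M : lmodType O) : Type := {scalar M}.

End Modules.

Section DualModule.
Variables (O : comPzRingType) (M : lmodType O).
Implicit Types f g h : dual M.

HB.instance Definition _ := gen_eqMixin (dual M).
HB.instance Definition _ := gen_choiceMixin (dual M).

Lemma dualP f g : (f : {scalar M}) =1 (g : {scalar M}) -> f = g.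
Proof.
move=> /funext; case: f => f [[cf] [sf]]; case: g => g [[cg] [sg]] /= E.
case: _ / E cg sg => cg sg.
by rewrite (Prop_irrelevance cf cg) (Prop_irrelevance sf sg).
Qed.

Definition dual0 : dual M := (\0 : M -> O).
Definition dualN f : dual M := (\- (f : {scalar M}) : M -> O).
Definition dualD f g : dual M := ((f : {scalar M}) \+ (g : {scalar M}) : M -> O).

Definition dualZ_fun (a : O) f : M -> O := fun x => a * (f : {scalar M}) x.

Lemma dualZ_scalar a f : scalar (dualZ_fun a f).
Proof. by move=> k x y; rewrite /dualZ_fun linearP mulrDr mulrCA. Qed.

HB.instance Definition _ a f :=
  GRing.isLinear.Build O M O *%R (dualZ_fun a f) (dualZ_scalar a f).

Definition dualZ a f : dual M := dualZ_fun a f.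

Lemma dualDA : associative dualD.
Proof. by move=> f g h; apply: dualP => x; apply: addrA. Qed.
Lemma dualDC : commutative dualD.
Proof. by move=> f g; apply: dualP => x; apply: addrC. Qed.
Lemma dual0D : left_id dual0 dualD.
Proof. by move=> f; apply: dualP => x; apply: add0r. Qed.
Lemma dualND : left_inverse dual0 dualN dualD.
Proof. by move=> f; apply: dualP => x; apply: addNr. Qed.

HB.instance Definition _ :=
  GRing.isZmodule.Build (dual M) dualDA dualDC dual0D dualND.

Lemma dualZA a b f : dualZ a (dualZ b f) = dualZ (a * b) f.
Proof. by apply: dualP => x; apply: mulrA. Qed.
Lemma dual1Z : left_id 1 dualZ.
Proof. by move=> f; apply: dualP => x; apply: mul1r. Qed.
Lemma dualZDr : right_distributive dualZ +%R.
Proof. by move=> a f g; apply: dualP => x; apply: mulrDr. Qed.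
Lemma dualZDl f : {morph dualZ^~ f : a b / a + b}.
Proof. by move=> a b; apply: dualP => x; apply: mulrDl. Qed.

HB.instance Definition _ :=
  GRing.Zmodule_isLmodule.Build O (dual M) dualZA dual1Z dualZDr dualZDl.

Definition evaluation (x : M) (f : dual M) : O := (f : {scalar M}) x.

Lemma evaluation_bilinear : is_bilinear_form evaluation.
Proof.
split=> //= [x y f | a x f]; rewrite /evaluation.
- exact: (linearD (f : {scalar M})).
- exact: (linearZ_LR (f : {scalar M})).
Qed.

End DualModule.

Record dualPair (K : comPzRingType) := DualPair {
  dp_alg : comPzRingType;
  dp_str : {rmorphism K -> dp_alg};
  dp_prim : lmodType dp_alg;
  dp_sec : lmodType dp_alg;
  pairing : dp_prim -> dp_sec -> dp_alg;
  pairing_bilinear : is_bilinear_form pairing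
}.
Arguments pairing {K d} _ _.

(* The action of the ground ring on the modules of a dual pair. *)
Definition kscale (K : comPzRingType) (P : dualPair K) (M : lmodType (dp_alg P))
  (k : K) (x : M) : M := dp_str P k *: x.

Definition dual_dualPair (K : comPzRingType) (O : comPzRingType)
    (str : {rmorphism K -> O}) (M : lmodType O) : dualPair K :=
  @DualPair K O str M (dual M) (@evaluation O M) (@evaluation_bilinear O M).

Record dualPairMorphism (K : comPzRingType) (P Q : dualPair K) := {
  mor_alg : {rmorphism dp_alg P -> dp_alg Q};
  mor_algK : forall k, mor_alg (dp_str P k) = dp_str Q k;
  mor_prim : {linear dp_prim P -> dp_prim Q | mor_alg \; *:%R};
  mor_sec : {linear dp_sec P -> dp_sec Q | mor_alg \; *:%R};
  mor_pairing : forall x w,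
    mor_alg (pairing x w) = pairing (mor_prim x) (mor_sec w)
}.

(* Isomorphism in the category of dual pairs: the algebra component may be any
   K-isomorphism, and the module components are equivariant along it. *)
Definition dualPair_isomorphic (K : comPzRingType) (P Q : dualPair K) : Prop :=
  exists (f : dualPairMorphism P Q) (g : dualPairMorphism Q P),
    [/\ cancel (mor_alg f) (mor_alg g) /\ cancel (mor_alg g) (mor_alg f),
        cancel (mor_prim f) (mor_prim g) /\ cancel (mor_prim g) (mor_prim f)
      & cancel (mor_sec f) (mor_sec g) /\ cancel (mor_sec g) (mor_sec f)].

Record is_lie_bracket (K : comPzRingType) (P : dualPair K)
    (X : lmodType (dp_alg P)) (br : X -> X -> X) : Prop := {
  lieDl : forall x y z, br (x + y) z = br x z + br y z;
  lieZl : forall k x y, br (kscale k x) y = kscale k (br x y);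
  lieDr : forall x y z, br x (y + z) = br x y + br x z;
  lieZr : forall k x y, br x (kscale k y) = kscale k (br x y);
  lie_alt : forall x, br x x = 0;
  lie_jacobi : forall x y z, br x (br y z) + br y (br z x) + br z (br x y) = 0
}.

Record rinehartSpace (K : comPzRingType) := RinehartSpace {
  rs_pair :> dualPair K;
  bracket : dp_prim rs_pair -> dp_prim rs_pair -> dp_prim rs_pair;
  bracket_lie : is_lie_bracket bracket;
  diff : dp_alg rs_pair -> dp_sec rs_pair;
  diffD : forall f g, diff (f + g) = diff f + diff g;
  diffZ : forall k f, diff (dp_str rs_pair k * f) = kscale k (diff f);
  diffM : forall f g, diff (f * g) = f *: diff g + g *: diff f;
  bracket_leibniz : forall x f y,
    bracket x (f *: y) = pairing x (diff f) *: y + f *: bracket x y;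
  tangent_findim : finite_dimensional (dp_prim rs_pair);
  cotangent_findim : finite_dimensional (dp_sec rs_pair);
  cotangent_spanned : forall w : dp_sec rs_pair,
    exists s : seq (dp_alg rs_pair * dp_alg rs_pair),
      w = \sum_(p <- s) p.1 *: diff p.2;
  pairing_nondegenerate : is_nondegenerate (@pairing K rs_pair)
}.

Definition fun_space (K : comPzRingType) (A : rinehartSpace K) : comPzRingType :=
  dp_alg A.
Definition tangent (K : comPzRingType) (A : rinehartSpace K) :
  lmodType (fun_space A) := dp_prim A.
Definition cotangent (K : comPzRingType) (A : rinehartSpace K) :
  lmodType (fun_space A) := dp_sec A.

Definition dir_deriv (K : comPzRingType) (A : rinehartSpace K)
  (x : tangent A) (f : fun_space A) : fun_space A := pairing x (diff f).

Record riemannianRinehartSpace (K : comPzRingType) := RiemannianRinehartSpace {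
  rrs_space :> rinehartSpace K;
  metric : tangent rrs_space -> tangent rrs_space -> fun_space rrs_space;
  metric_bilinear : is_bilinear_form metric;
  metric_sym : forall x y, metric x y = metric y x
}.
Arguments metric {K r} _ _.

Section Riemannian.
Variables (K : comPzRingType) (A : riemannianRinehartSpace K).

Definition duplicates (y : tangent A) (w : cotangent A) : Prop :=
  forall x : tangent A, pairing x w = metric x y.

Definition duplicative : Prop :=
  (forall y : tangent A, exists w : cotangent A, duplicates y w) /\
  (forall w : cotangent A, exists y : tangent A, duplicates y w).

Record is_covariant_derivative
    (nabla : tangent A -> tangent A -> tangent A) : Prop := {
  nablaDl : forall x y z, nabla (x + y) z = nabla x z + nabla y z;
  nablaZl : forall f x y, nabla (f *: x) y = f *: nabla x y;
  nablaDr : forall x y z, nabla x (y + z) = nabla x y + nabla x z;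
  nablaKr : forall k x y, nabla x (kscale k y) = kscale k (nabla x y);
  nabla_leibniz : forall x f y,
    nabla x (f *: y) = dir_deriv x f *: y + f *: nabla x y
}.

Record is_levi_civita
    (nabla : tangent A -> tangent A -> tangent A) : Prop := {
  lc_covariant : is_covariant_derivative nabla;
  lc_torsion_free : forall x y, bracket x y = nabla x y - nabla y x;
  lc_metric : forall x y z,
    dir_deriv x (metric y z) = metric (nabla x y) z + metric y (nabla x z)
}.

End Riemannian.

(* Main.v *)
Require Import Defs.
From HB Require Import structures.
From mathcomp Require Import all_boot all_order all_algebra.
From mathcomp Require Import boolp ring.
Import GRing.Theory.
Local Open Scope ring_scope.

(** The classical argument is Koszul's: permuting the three vector fields in
    the metric condition and eliminating the antisymmetric part of nabla by
    torsion-freeness determines [2 <nabla_X Y, Z>] as an expression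
    [koszul X Y Z] in the metric and the bracket only ([levi_civita_koszul]).
    When the metric separates points and 2 is invertible this gives uniqueness.
    For existence, [koszul X Y Z] is O-linear in Z, so half of it is a linear
    functional of Z.  An isomorphism of (X, Omega) with (X, Hom(X, O)), even one
    that twists the function algebra, makes every functional the pairing with a
    cotangent vector ([functional_is_pairing]); a duplicate of that vector is
    the wanted value [nabla_X Y].  The axioms of a Levi-Civita connection then
    reduce, by non-degeneracy, to identities of the Koszul expression.

    Non-degeneracy is a convention when the tensor square of the tangent module
    vanishes, and metrics need not separate points then.  In that case every
    O-bilinear map on the tangent module is zero ([bilinear_of_tensor0]).  The
    difference of two covariant derivatives is such a map, whence uniqueness.
    Duplicates turn the pairing into a value of the vanishing metric, so all
    directional derivatives vanish; the bracket is then O-bilinear, hence zero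
    too, and the zero connection is Levi-Civita. *)

(** * Modules *)

(** Such a map factors through the tensor product. *)
Lemma bilinear_of_tensor0 (O : comPzRingType) (M W P : lmodType O)
    (b : M -> W -> P) :
  tensor_is_zero M W -> is_bilinear b -> forall x w, b x w = 0.
Proof.
move=> [T [tau [[_ univ] T0]]] /univ [phi [phiE _]] x w.
by rewrite -phiE (T0 (tau x w)) linear0.
Qed.

(** An isomorphism of dual pairs acts on the algebra by some automorphism s and
    on M by an s-semilinear bijection F.  A functional phi is therefore first
    transported to [s \o phi \o F^-1], which is again linear over O. *)
Lemma functional_is_pairing (K : comPzRingType) (P : dualPair K)
    (phi : dp_prim P -> dp_alg P) :
  dualPair_isomorphic P (dual_dualPair (dp_str P) (dp_prim P)) ->
  scalar phi -> exists w, forall x, pairing x w = phi x.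
Proof.
move=> [f [g [[fgK gfK] [fgP gfP] [fgS gfS]]]] phi_lin.
pose psi x := mor_alg f (phi (mor_prim g x)).
have psi_lin : scalar psi.
  move=> a x y; rewrite /psi.
  have -> : mor_prim g (a *: x + y)
          = mor_alg g a *: mor_prim g x + mor_prim g y.
    by rewrite linearD linearZ.
  by rewrite phi_lin rmorphD rmorphM gfK.
pose psiL := GRing.isLinear.Build _ _ _ _ psi psi_lin.
pose psiD : dual (dp_prim P) := HB.pack_for {scalar dp_prim P} psi psiL.
exists (mor_sec g psiD) => x.
apply: (can_inj fgK); rewrite mor_pairing gfS.
by rewrite /= /evaluation /= /psi fgP.
Qed.

(** * Derivations, brackets and metrics *)

Section Calculus.
Variables (K : comPzRingType) (A : riemannianRinehartSpace K).
Implicit Types (x y z u v : tangent A) (f : fun_space A).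

Local Notation "''D_' x f" := (@dir_deriv K A x f)
  (at level 10, x at level 8, f at level 9).
Local Notation "<< x , y >>" := (@metric K A x y).
Local Notation "[ 'lie' x , y ]" := (@bracket K A x y).

Lemma dir_derivDl x y f : 'D_(x + y) f = 'D_x f + 'D_y f.
Proof. exact: (bilinDl (@pairing_bilinear K A)). Qed.

Lemma dir_derivZl a x f : 'D_(a *: x) f = a * 'D_x f.
Proof. exact: (bilinZl (@pairing_bilinear K A)). Qed.

Lemma dir_derivD x f f' : 'D_x (f + f') = 'D_x f + 'D_x f'.
Proof. by rewrite /dir_deriv diffD (bilinDr (@pairing_bilinear K A)). Qed.

Lemma dir_derivM x f f' : 'D_x (f * f') = f * 'D_x f' + f' * 'D_x f.
Proof.
by rewrite /dir_deriv diffM (bilinDr (@pairing_bilinear K A))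
  !(bilinZr (@pairing_bilinear K A)).
Qed.

Lemma diff1 : diff (1 : dp_alg A) = 0.
Proof.
have := diffM (1 : dp_alg A) 1.
by rewrite mulr1 scale1r => /eqP; rewrite -subr_eq subrr eq_sym => /eqP.
Qed.

(** K-linearity of [diff] and [diff 1 = 0] make the ground ring constant; the
    K-linearity of a covariant derivative is then a case of its Leibniz rule. *)
Lemma dir_deriv_const x k : 'D_x (dp_str A k) = 0.
Proof.
have := diffZ k (1 : dp_alg A); rewrite mulr1 diff1 /kscale scaler0 => dk.
rewrite /dir_deriv dk -(scale0r (0 : dp_sec A)).
by rewrite (bilinZr (@pairing_bilinear K A)) scale0r.
Qed.

Lemma metricDl x y z : <<x + y, z>> = <<x, z>> + <<y, z>>.
Proof. exact: (bilinDl (@metric_bilinear K A)). Qed.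

Lemma metricZl a x z : <<a *: x, z>> = a * <<x, z>>.
Proof. exact: (bilinZl (@metric_bilinear K A)). Qed.

Lemma metricNl x z : <<- x, z>> = - <<x, z>>.
Proof. by rewrite -scaleN1r metricZl mulN1r. Qed.

Lemma metricBl x y z : <<x - y, z>> = <<x, z>> - <<y, z>>.
Proof. by rewrite metricDl metricNl. Qed.

Lemma metricDr x y z : <<z, x + y>> = <<z, x>> + <<z, y>>.
Proof. exact: (bilinDr (@metric_bilinear K A)). Qed.

Lemma metricZr a x z : <<z, a *: x>> = a * <<z, x>>.
Proof. exact: (bilinZr (@metric_bilinear K A)). Qed.

Lemma bracketDl x y z : [lie x + y, z] = [lie x, z] + [lie y, z].
Proof. exact: (lieDl (bracket_lie A)). Qed.

Lemma bracketDr x y z : [lie x, y + z] = [lie x, y] + [lie x, z].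
Proof. exact: (lieDr (bracket_lie A)). Qed.

Lemma bracketC x y : [lie x, y] = - [lie y, x].
Proof.
have alt u : [lie u, u] = 0 := lie_alt (bracket_lie A) u.
apply/eqP; rewrite -addr_eq0; apply/eqP.
by have := alt (x + y); rewrite bracketDl !bracketDr !alt add0r addr0.
Qed.

Lemma bracketZr x f y : [lie x, f *: y] = 'D_x f *: y + f *: [lie x, y].
Proof. exact: bracket_leibniz. Qed.

Lemma bracketZl f x y : [lie f *: x, y] = f *: [lie x, y] - 'D_y f *: x.
Proof.
by rewrite bracketC bracketZr (bracketC y x) scalerN opprD opprK addrC.
Qed.

(** The Leibniz terms of two covariant derivatives are the same and cancel. *)
Lemma covariant_derivative_subr_bilinear nabla nabla' :
  @is_covariant_derivative K A nabla -> is_covariant_derivative nabla' ->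
  is_bilinear (fun x y => nabla x y - nabla' x y).
Proof.
move=> c c'; split=> [x y z|a x z|x y z|x a z].
- by rewrite (nablaDl c) (nablaDl c') opprD addrACA.
- by rewrite (nablaZl c) (nablaZl c') scalerBr.
- by rewrite (nablaDr c) (nablaDr c') opprD addrACA.
- rewrite (nabla_leibniz c) (nabla_leibniz c') opprD addrACA subrr.
  by rewrite add0r scalerBr.
Qed.

(** * The Koszul expression *)

Definition koszul x y z : fun_space A :=
  'D_x <<y, z>> + 'D_y <<x, z>> - 'D_z <<x, y>>
  + <<[lie x, y], z>> - <<[lie x, z], y>> - <<[lie y, z], x>>.

(** Expanding every term of the Koszul expression in nabla, each of
    [nabla y x], [nabla x z], [nabla z x], [nabla y z] and [nabla z y] occurs
    twice with opposite signs, and [nabla x y] twice with the same sign. *)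
Lemma levi_civita_koszul nabla x y z :
  @is_levi_civita K A nabla -> 2%:R * <<nabla x y, z>> = koszul x y z.
Proof.
move=> lc; rewrite /koszul !(lc_metric lc) !(lc_torsion_free lc) !metricBl.
rewrite (metric_sym y) (metric_sym x (nabla y z)) (metric_sym x (nabla z y)).
ring.
Qed.

(** The Leibniz terms in z cancel: those of [<<x, z>>] and [<<y, z>>] against
    those of the brackets with z. *)
Lemma koszul_scalar x y : scalar (koszul x y).
Proof.
move=> a u v; rewrite /koszul.
rewrite !(metricDr, metricZr, dir_derivD, dir_derivM, dir_derivDl, dir_derivZl,
  bracketDr, bracketZr, metricDl, metricZl) (metric_sym u x) (metric_sym u y).
ring.
Qed.

Lemma koszulDl x y z u : koszul (x + y) z u = koszul x z u + koszul y z u.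
Proof.
rewrite /koszul.
rewrite !(metricDr, dir_derivD, dir_derivDl, bracketDl, metricDl).
ring.
Qed.

Lemma koszulZl a x y z : koszul (a *: x) y z = a * koszul x y z.
Proof.
rewrite /koszul.
rewrite !(metricZr, dir_derivM, dir_derivZl, bracketZl, metricBl, metricZl).
ring.
Qed.

(** This is torsion-freeness, at the level of the Koszul expression; it also
    transfers properties of the first argument to the second. *)
Lemma koszul_sub x y z : koszul x y z - koszul y x z = 2%:R * <<[lie x, y], z>>.
Proof.
rewrite /koszul (metric_sym y x) (bracketC y x) metricNl.
ring.
Qed.

(** This is the compatibility with the metric, at the level of the Koszul
    expression. *)
Lemma koszul_add x y z : koszul x y z + koszul x z y = 2%:R * 'D_x <<y, z>>.
Proof.
rewrite /koszul (metric_sym z y) (bracketC z y) metricNl.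
ring.
Qed.

Lemma koszulDm x y z u : koszul x (y + z) u = koszul x y u + koszul x z u.
Proof.
apply/eqP; rewrite -subr_eq0; apply/eqP.
have e v : koszul x v u = koszul v x u + 2%:R * <<[lie x, v], u>>.
  by rewrite -koszul_sub addrC subrK.
rewrite !e koszulDl bracketDr metricDl.
ring.
Qed.

Lemma koszul_leibniz x f y z :
  koszul x (f *: y) z = f * koszul x y z + 2%:R * ('D_x f * <<y, z>>).
Proof.
have e v : koszul x v z = koszul v x z + 2%:R * <<[lie x, v], z>>.
  by rewrite -koszul_sub addrC subrK.
rewrite !e koszulZl bracketZr metricDl !metricZl.
ring.
Qed.

(** * Uniqueness and existence *)

Section Half.
Hypothesis two_unit : exists h : K, h * 2%:R = 1.

Lemma half_exists : exists h : fun_space A, h * 2%:R = 1.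
Proof.
case: two_unit => h h2; exists (dp_str A h).
by rewrite -(rmorph_nat (dp_str A)) -rmorphM h2 rmorph1.
Qed.

Lemma mul2I (a b : fun_space A) : 2%:R * a = 2%:R * b -> a = b.
Proof.
case: half_exists => h h2 ab.
by rewrite -[a]mul1r -[b]mul1r -h2 -!mulrA ab.
Qed.

Section Separating.
Hypothesis metric_separates : forall x, x <> 0 -> exists y, <<x, y>> <> 0.

Lemma metric_inj x y : (forall z, <<x, z>> = <<y, z>>) -> x = y.
Proof.
move=> xy; apply: contrapT => nxy.
have [|z] := metric_separates (x - y).
  by move/eqP; rewrite subr_eq0 => /eqP.
by rewrite metricBl xy subrr.
Qed.

(** The Koszul formula is not only necessary: paired with an arbitrary vector
    and doubled, each axiom is an identity of [koszul]. *)
Lemma levi_civita_of_koszul (nabla : tangent A -> tangent A -> tangent A) :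
  (forall x y z, 2%:R * <<nabla x y, z>> = koszul x y z) ->
  is_levi_civita nabla.
Proof.
move=> nablaE.
have leib x f y : nabla x (f *: y) = 'D_x f *: y + f *: nabla x y.
  apply: metric_inj => z; apply: mul2I.
  rewrite nablaE koszul_leibniz -nablaE metricDl !metricZl; ring.
split=> [|x y|x y z]; first split=> [x y z|f x y|x y z|k x y|//].
- by apply: metric_inj => u; apply: mul2I;
    rewrite metricDl mulrDr !nablaE koszulDl.
- by apply: metric_inj => u; apply: mul2I;
    rewrite metricZl mulrCA !nablaE koszulZl.
- by apply: metric_inj => u; apply: mul2I;
    rewrite metricDl mulrDr !nablaE koszulDm.
- by rewrite /kscale leib dir_deriv_const scale0r add0r.
- by apply: metric_inj => u; apply: mul2I;
    rewrite metricBl mulrBr !nablaE koszul_sub.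
- by apply: mul2I; rewrite mulrDr (metric_sym y (nabla x z)) !nablaE koszul_add.
Qed.

Lemma levi_civita_exists_separating :
  duplicative A ->
  dualPair_isomorphic A (dual_dualPair (dp_str A) (tangent A)) ->
  exists nabla : tangent A -> tangent A -> tangent A, is_levi_civita nabla.
Proof.
move=> [_ dupl] iso; have [h h2] := half_exists.
have nablaP x y : exists u, forall z, 2%:R * <<u, z>> = koszul x y z.
  have lin : scalar (fun z => h * koszul x y z).
    by move=> a u v; rewrite koszul_scalar mulrDr mulrCA.
  have [w wE] := functional_is_pairing K A _ iso lin.
  have [u uw] := dupl w; exists u => z.
  by rewrite metric_sym -uw wE mulrA (mulrC 2%:R) h2 mul1r.
pose nabla x y := projT1 (cid (nablaP x y)).
exists nabla; apply: levi_civita_of_koszul => x y.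
exact: projT2 (cid (nablaP x y)).
Qed.

Lemma levi_civita_unique_separating nabla nabla' :
  @is_levi_civita K A nabla -> is_levi_civita nabla' -> nabla = nabla'.
Proof.
move=> lc lc'; apply/funext => x; apply/funext => y.
by apply: metric_inj => z; apply: mul2I; rewrite !levi_civita_koszul.
Qed.

End Separating.
End Half.

Section VanishingTensorSquare.
Hypothesis tensor0 : tensor_is_zero (tangent A) (tangent A).

Lemma covariant_derivative_unique_tensor0 nabla nabla' :
  @is_covariant_derivative K A nabla -> is_covariant_derivative nabla' ->
  nabla = nabla'.
Proof.
move=> c c'; apply/funext => x; apply/funext => y; apply/eqP.
have bil := covariant_derivative_subr_bilinear _ _ c c'.
by rewrite -subr_eq0 (bilinear_of_tensor0 _ _ _ _ _ tensor0 bil).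
Qed.

(** By duplication each derivative [<x, diff f>] is a value of the metric, which
    is zero here; with no Leibniz term left, the bracket is O-bilinear and so
    vanishes as well. *)
Lemma levi_civita_exists_tensor0 :
  duplicative A ->
  exists nabla : tangent A -> tangent A -> tangent A, is_levi_civita nabla.
Proof.
move=> [_ dupl].
have D0 x f : 'D_x f = 0.
  have [y yE] := dupl (diff f); rewrite /dir_deriv yE.
  exact: (bilinear_of_tensor0 _ _ _ _ _ tensor0 (@metric_bilinear K A)).
have br_bilin : is_bilinear (@bracket K A).
  split=> [x y z|a x z|x y z|x a z].
  - exact: bracketDl.
  - by rewrite bracketZl D0 scale0r subr0.
  - exact: bracketDr.
  - by rewrite bracketZr D0 scale0r add0r.
have br0 := bilinear_of_tensor0 _ _ _ _ _ tensor0 br_bilin.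
have g0 := bilinear_of_tensor0 _ _ _ _ _ tensor0 (@metric_bilinear K A).
exists (fun _ _ => 0); split=> [|x y|x y z].
- by split=> *; rewrite /kscale ?D0 ?scale0r ?scaler0 ?addr0.
- by rewrite br0 subr0.
- by rewrite D0 !g0 addr0.
Qed.

End VanishingTensorSquare.
End Calculus.

Theorem theorem2p4p25 (K : comPzRingType) (A : riemannianRinehartSpace K)
    (two_unit : exists h : K, h * 2%:R = 1)
    (metric_nondeg : is_nondegenerate (@metric K A)) :
  (forall nabla nabla' : tangent A -> tangent A -> tangent A,
     is_levi_civita nabla -> is_levi_civita nabla' -> nabla = nabla') /\
  (duplicative A ->
   dualPair_isomorphic A (dual_dualPair (dp_str A) (tangent A)) ->
   exists nabla : tangent A -> tangent A -> tangent A, is_levi_civita nabla).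
Proof.
have [tensor0|/metric_nondeg [sep _]] :=
  pselect (tensor_is_zero (tangent A) (tangent A)).
  split=> [nabla nabla' [c _ _] [c' _ _]|dupl _].
  - exact: covariant_derivative_unique_tensor0 tensor0 _ _ c c'.
  - exact: levi_civita_exists_tensor0 tensor0 dupl.
split=> [nabla nabla'|].
- exact: levi_civita_unique_separating two_unit sep _ _.
- exact: levi_civita_exists_separating two_unit sep.
Qed.
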